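(* Let $x=(x^1,\dots,x^d)$ and $q=(q^1,\dots,q^d)$ be i.i.d. random vectors in $\mathbb{R}^d$, and let $p>0$. Suppose that for each $j$ the coordinates $x^j$ and $q^j$ are distributed as a random variable $V_j$, except that each has only probability $s_j$ of having a non-zero value, where $0<s_j\le 1$ (that is, with probability $s_j$ the coordinate is distributed as $V_j$, and with probability $1-s_j$ it equals $0$). Let $m_{j,r}$ be the $r$-th moment of $|V_j|$, and let $m'_{j,r}$ be the $r$-th moment of $|V_{j1}-V_{j2}|$, where $V_{j1}$ and $V_{j2}$ are independently distributed as $V_j$. Put $R_j=E_q\left[|x^j-q^j|^p\right]$ and $R=\sum_{j=1}^d R_j$, let $\mu=E[R]$ and $\sigma^2=\mathrm{var}[R]$, and let $\sigma'^2=\sigma^2/\mu^2$ be the normalized variance. If the dimensions are independent, then $$\sigma'^2=\frac{\sum_{j=1}^{d}\left(s_j^2\,m'_{j,2p}+2(1-s_j)s_j\,m_{j,2p}-\mu_j^2\right)}{\left(\sum_{j=1}^{d}\mu_j\right)^2},\qquad\text{where}\quad \mu_j=s_j^2\,m'_{j,p}+2(1-s_j)s_j\,m_{j,p}.$$ Moreover, if the dimensions are i.i.d. (so that the subscript $j$ can be dropped: $s_j=s$, $m_{j,r}=m_r$, $m'_{j,r}=m'_r$), then $$\sigma'=\frac{1}{d^{1/2}}\sqrt{\frac{s\left[(m'_{2p}-2m_{2p})s+2m_{2p}\right]}{s^2\left[(m'_p-2m_p)s+2m_p\right]^2}-1}.$$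
   Context: Here $x$ is a random database point and $q$ a random query, i.i.d. from an unknown distribution, and distances are $L_p$ distances $D(x,q)=\left(\sum_j|x^j-q^j|^p\right)^{1/p}$. $E_q$ denotes expectation over the query $q$; $R_j$ and $R$ are regarded as random variables because $x^j$ is a random variable. Each $R_j$ is supposed to have finite mean $E[R_j]$ and finite variance $\mathrm{var}[R_j]$. The normalized variance $\sigma'^2$ is the variance of $R$ after the data are scaled so that the mean of $R$ equals $1$.
   Formalization: The variance σ² (and the finite variance assumed for each R_j) is taken of Σ_j|x^j−q^j|^p (of |x^j−q^j|^p) over both x and q, not of E_q[...] over x alone; as stated the formula fails, e.g. d=p=s=1, V=±1 equiprobable: var[R]=0 but the formula gives 1. *)

(* Defs.v *)
From mathcomp Require Import all_boot all_order all_algebra.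
From mathcomp Require Import all_classical all_reals all_analysis.

Set Implicit Arguments.
Unset Strict Implicit.
Unset Printing Implicit Defensive.

Import Order.TTheory GRing.Theory Num.Theory.
Import numFieldNormedType.Exports.

Local Open Scope classical_set_scope.
Local Open Scope ring_scope.

Definition same_law {d d'} {T : measurableType d} {T' : measurableType d'}
    {R : realType} (P : probability T R) (X Y : {RV P >-> T'}) : Prop :=
  forall A : set T', measurable A -> distribution P X A = distribution P Y A.

Definition independent2 {d d'} {T : measurableType d} {T' : measurableType d'}
    {R : realType} (P : probability T R) (X Y : {RV P >-> T'}) : Prop :=
  forall A B : set T', measurable A -> measurable B ->
    P (X @^-1` A `&` Y @^-1` B) = (P (X @^-1` A) * P (Y @^-1` B))%E.

Definition iid2 {d d'} {T : measurableType d} {T' : measurableType d'}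
    {R : realType} (P : probability T R) (X Y : {RV P >-> T'}) : Prop :=
  same_law X Y /\ independent2 X Y.

(* Y is distributed as V with probability s, and equals 0 with probability
   1 - s: its law is s law(V) + (1 - s) delta_0. *)
Definition sparse_law {d d'} {T : measurableType d} {T' : measurableType d'}
    {R : realType} (P : probability T R) (Q : probability T' R)
    (Y : T -> R) (s : R) (V : {RV Q >-> R}) : Prop :=
  forall A : set R, measurable A ->
    P (Y @^-1` A) =
    (s%:E * distribution Q V A + (1 - s)%:E * \d_(0%R : R) A)%E.

Section random_vectors.
Context {d : measure_display} {T : measurableType d} {R : realType}.
Context {P : probability T R} {n : nat}.

(* A random vector of R^n is a random variable with values in n.-tuple R, whose
   sigma-algebra is the one generated by the coordinates, i.e. the Borel one. *)
Definition coordRV (x : {RV P >-> n.-tuple R}) (j : 'I_n) : T -> R :=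
  fun t => tnth (x t) j.

Definition independent_coords (x : {RV P >-> n.-tuple R}) : Prop :=
  forall (J : {set 'I_n}) (B : 'I_n -> set R), (forall j, measurable (B j)) ->
    P (\bigcap_(j in [set` J]) (coordRV x j @^-1` B j)) =
    (\prod_(j in J) P (coordRV x j @^-1` B j))%E.

Variables (p : R) (x q : {RV P >-> n.-tuple R}).

Definition pdist_coord (j : 'I_n) : T -> R :=
  fun t => `|coordRV x j t - coordRV q j t| `^ p.

(* D(x, q)^p *)
Definition pdist : T -> R := fun t => \sum_(j < n) pdist_coord j t.

(* E_q[|x^j - q^j|^p] as a function of the sample point t through x alone: the
   query is averaged out over its own copy u of the sample space, which is the
   expectation over q given x when x and q are independent. *)
Definition Rcoord (j : 'I_n) : T -> \bar R :=
  fun t => ('E_P[fun u => (`|coordRV x j t - coordRV q j u| `^ p)%R])%E.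

Definition Rtot : T -> \bar R := fun t => (\sum_(j < n) Rcoord j t)%E.

Definition mu : R := fine (\int[P]_t Rtot t)%E.

(* The variance is over the draw of both x and q, i.e. it is
   E_x[E_q[(D(x, q)^p - mu)^2]], whose mean mu is that of Rtot.  The variance
   of the conditional expectation Rtot is smaller in general: for n = 1, p = 1,
   and V = 1 or -1 with probability 1/2 each, never zeroed, Rtot is the
   constant 1, whereas the normalized variance of D(x, q)^p is
   m'_2 / m'_1 ^ 2 - 1 = 1. *)
Definition sigma2 : R := fine ('V_P[pdist])%E.

Definition normalized_variance : R := sigma2 / mu ^+ 2.

Definition normalized_sd : R := Num.sqrt normalized_variance.

Definition finite_mean_variance (j : 'I_n) : Prop :=
  (\int[P]_t Rcoord j t < +oo)%E /\ ('V_P[pdist_coord j] < +oo)%E.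

End random_vectors.

Definition absmoment {d} {T : measurableType d} {R : realType}
    (Q : probability T R) (X : T -> R) (r : R) : R :=
  fine ('E_Q[fun w => (`|X w| `^ r)%R])%E.

(* Main.v *)
(* By Tonelli, E|x^j - q^j|^r is the double integral of |a - b|^r against the
   square of the law s law(V_j) + (1 - s) delta_0 of x^j; expanding the square
   gives s^2 m'_{j,r} + 2 (1 - s) s m_{j,r}, the delta-delta term being 0^r = 0.
   With r = p and r = 2p these are the mean and the second moment of
   |x^j - q^j|^p.  The summands of D(x, q)^p are pairwise uncorrelated, because
   x and q are independent and each has independent coordinates, so their
   variances add up. *)
Require Import Defs.
From HB Require Import structures.
From mathcomp Require Import all_boot all_order all_algebra.
From mathcomp Require Import all_classical all_reals all_analysis.
From mathcomp Require Import measurable_realfun ring.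

Import Order.TTheory GRing.Theory Num.Theory.
Import numFieldNormedType.Exports.
Local Open Scope classical_set_scope.
Local Open Scope ring_scope.

(** * Integration over a pair of independent random variables *)

Section independence.
Context {dT d1 d2 : measure_display} {T : measurableType dT}
  {T1 : measurableType d1} {T2 : measurableType d2} {R : realType}
  {P : probability T R} {X : {RV P >-> T1}} {Y : {RV P >-> T2}}.
Hypothesis XY_indep : forall A B, measurable A -> measurable B ->
  P (X @^-1` A `&` Y @^-1` B) = (P (X @^-1` A) * P (Y @^-1` B))%E.
Local Open Scope ereal_scope.

Let XY t := (X t, Y t).

Let measurable_XY : measurable_fun setT XY.
Proof. exact: measurable_fun_pair. Qed.

HB.instance Definition _ := isMeasurableFun.Build _ _ _ _ XY measurable_XY.

(** Independence says that the joint law of [X] and [Y] agrees with the product of their laws on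
    rectangles, hence everywhere by uniqueness of the product measure; Tonelli then iterates the
    integral. Back on the sample space, [t] and [u] run over two separate copies of [T]. *)
Lemma ge0_integral_indep (f : T1 * T2 -> \bar R) :
  measurable_fun setT f -> (forall z, 0 <= f z) ->
  \int[P]_t f (X t, Y t) = \int[P]_t \int[P]_u f (X t, Y u).
Proof.
move=> mf f0.
transitivity (\int[distribution P XY]_z f z).
  by rewrite ge0_integral_distribution.
transitivity (\int[distribution P X \x distribution P Y]_z f z).
  apply: eq_measure_integral => A mA _; apply/esym.
  by apply: product_measure_unique => // B C mB mC; exact: XY_indep.
rewrite fubini_tonelli1// ge0_integral_distribution//; last 2 first.
- exact: measurable_fun_fubini_tonelli_F.
- by move=> a; exact: integral_ge0.
apply: eq_integral => t _ /=; rewrite /fubini_F ge0_integral_distribution//.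
exact: measurableT_comp.
Qed.

Lemma ge0_integralM_indep (f : T1 -> \bar R) (g : T2 -> \bar R) :
  measurable_fun setT f -> measurable_fun setT g ->
  (forall a, 0 <= f a) -> (forall b, 0 <= g b) ->
  \int[P]_t (f (X t) * g (Y t)) =
  \int[P]_t f (X t) * \int[P]_t g (Y t).
Proof.
move=> mf mg f0 g0.
rewrite (@ge0_integral_indep (fun z => f z.1 * g z.2)); last 2 first.
- by apply: emeasurable_funM; exact: measurableT_comp.
- by move=> z; exact: mule_ge0.
have mgY : measurable_fun setT (fun u => g (Y u)) by exact: measurableT_comp.
transitivity (\int[P]_t (f (X t) * \int[P]_u g (Y u))).
  by apply: eq_integral => t _; rewrite /= (ge0_integralZl _ measurableT mgY)//=.
rewrite ge0_integralZr//; first exact: measurableT_comp.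
exact: integral_ge0.
Qed.

End independence.

(** * Nonnegative integrals as functions of the law *)

Lemma same_law_ge0_integral {dT dU : measure_display} {T : measurableType dT}
    {U : measurableType dU} {R : realType} {P : probability T R}
    {X Y : {RV P >-> U}} (f : U -> \bar R) :
  same_law X Y -> measurable_fun setT f -> (forall a, (0 <= f a)%E) ->
  (\int[P]_t f (X t) = \int[P]_t f (Y t))%E.
Proof.
move=> XY mf f0.
transitivity (\int[distribution P X]_a f a)%E.
  by rewrite ge0_integral_distribution.
transitivity (\int[distribution P Y]_a f a)%E.
  by apply: eq_measure_integral => A mA _; exact: XY.
by rewrite ge0_integral_distribution.
Qed.

(** The law of [Y] is a sum of two scaled measures, and the integral is additive in the measure; the
    Dirac part evaluates [f] at 0. *)
Lemma sparse_law_ge0_integral {dT dU : measure_display} {T : measurableType dT}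
    {U : measurableType dU} {R : realType} {P : probability T R}
    {Q : probability U R} {Y : {RV P >-> R}} {s : R} {V : {RV Q >-> R}}
    (f : R -> \bar R) :
  0 <= s <= 1 -> sparse_law P Y s V ->
  measurable_fun setT f -> (forall a, (0 <= f a)%E) ->
  (\int[P]_t f (Y t) = s%:E * \int[Q]_w f (V w) + (1 - s)%:E * f 0%R)%E.
Proof.
move=> /andP[s0 s1] YV mf f0.
have s1' : 0 <= 1 - s by rewrite subr_ge0.
transitivity (\int[distribution P Y]_a f a)%E.
  by rewrite ge0_integral_distribution.
transitivity (\int[measure_add (mscale (NngNum s0) (distribution Q V))
    (mscale (NngNum s1') \d_(0%R : R))]_a f a)%E.
  apply: eq_measure_integral => A mA _.
  rewrite [RHS]measure_addE /= /mscale/=; exact: YV.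
rewrite ge0_integral_measure_add// !ge0_integral_mscale//.
by rewrite ge0_integral_distribution// integral_dirac// diracT mul1e.
Qed.

(** * Variance of a sum of uncorrelated square integrable variables *)

Section variance_of_sum.
Context {d : measure_display} {T : measurableType d} {R : realType}
  (P : probability T R).
Local Open Scope ereal_scope.

Lemma Lfun2_sum (I : Type) (s : seq I) (X : I -> T -> R) :
  (forall i, X i \in Lfun P 2%:E) -> (\sum_(i <- s) X i)%R \in Lfun P 2%:E.
Proof.
move=> X2; apply: rpred_sum; first by rewrite lee_fin ler1n.
move=> le12 i _; exact: X2.
Qed.

Lemma covariance_suml (I : Type) (s : seq I) (X : I -> T -> R) (Z : T -> R) :
  (forall i, X i \in Lfun P 2%:E) -> Z \in Lfun P 2%:E ->
  covariance P (\sum_(i <- s) X i)%R Z = \sum_(i <- s) covariance P (X i) Z.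
Proof.
move=> X2 Z2; elim: s => [|i s IHs].
  by rewrite !big_nil covariance_cst_l.
rewrite !big_cons covarianceDl ?IHs//.
exact: Lfun2_sum.
Qed.

Lemma variance_sum_uncorrelated (I : finType) (X : I -> T -> R) :
  (forall i, X i \in Lfun P 2%:E) ->
  (forall i j, i != j -> 'E_P[X i * X j] = 'E_P[X i] * 'E_P[X j]) ->
  'V_P[\sum_i X i]%R = \sum_i 'V_P[X i].
Proof.
move=> X2 XX; rewrite /variance covariance_suml//; last first.
  exact: Lfun2_sum.
apply: eq_bigr => i _; rewrite covarianceC covariance_suml//.
(* By bilinearity the variance is a double sum of covariances; only the diagonal term of each row
   survives. *)
rewrite (bigD1 i)//= big1 ?adde0// => j ji.
have X1 k : X k \in Lfun P 1 by rewrite Lfun_subset12 ?fin_num_measure.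
rewrite covarianceE ?Lfun2_mul_Lfun1// XX// subee// fin_numM//;
  exact: expectation_fin_num.
Qed.

(* X - E X is square integrable, and constants are; if E X is infinite, fine
   makes the centring constant 0. *)
Lemma variance_lty_Lfun2 (X : T -> R) : measurable_fun setT X ->
  'V_P[X] < +oo -> X \in Lfun P 2%:E.
Proof.
move=> mX VX; set c := fine 'E_P[X].
have -> : X = ((X - cst c) + cst c)%R by rewrite subrK.
apply: rpredD => [|le12|le12]; [by rewrite lee_fin ler1n| |exact: Lfun_cst].
have mXc : measurable_fun setT (X - cst c)%R by exact: measurable_funB.
rewrite inE; apply/andP; split; rewrite inE//= /finite_norm unlock /Lnorm.
rewrite poweR_lty//.
rewrite [ltLHS](_ : _ = 'V_P[X])// /variance covariance.unlock
  expectation.unlock.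
apply: eq_integral => t _ /=.
rewrite powR_mulrn; last exact: normr_ge0.
rewrite real_normK; last exact: num_real.
by rewrite /c expectation.unlock expr2.
Qed.

End variance_of_sum.

(** * Independent pairs with a common law *)

Section pair_laws.
Context {dT dU : measure_display} {T : measurableType dT}
  {U : measurableType dU} {R : realType} {P : probability T R}.
Local Open Scope ereal_scope.

Lemma measurable_integral_comp (Z : {RV P >-> U}) (f : U * U -> \bar R) :
  measurable_fun setT f -> (forall z, 0 <= f z) ->
  measurable_fun setT (fun a => \int[P]_u f (a, Z u)).
Proof.
move=> mf f0.
apply: (@measurable_fun_fubini_tonelli_F _ _ U T R P (fun z => f (z.1, Z z.2))).
  apply: (measurableT_comp mf).
  by apply: measurable_fun_pair => //; exact: measurableT_comp.
by [].
Qed.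

(** Once the integral is iterated, each variable is integrated separately and can be exchanged for
    [Z], first the inner one and then the outer one. This serves both for the pair of [x] and [q]
    and for the pair of [V1] and [V2]. *)
Lemma indep_same_law_ge0_integral {X Y Z : {RV P >-> U}} (f : U * U -> \bar R) :
  independent2 X Y -> same_law X Z -> same_law Y Z ->
  measurable_fun setT f -> (forall z, 0 <= f z) ->
  \int[P]_t f (X t, Y t) = \int[P]_t \int[P]_u f (Z t, Z u).
Proof.
move=> XY XZ YZ mf f0; rewrite ge0_integral_indep//.
have mfa a : measurable_fun setT (fun b => f (a, b)).
  by apply: (measurableT_comp mf); exact: measurable_fun_pair.
transitivity (\int[P]_t \int[P]_u f (X t, Z u)).
  apply: eq_integral => t _.
  exact: (same_law_ge0_integral (fun b => f (X t, b)) YZ).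
apply: (same_law_ge0_integral (fun a => \int[P]_u f (a, Z u)) XZ).
  exact: measurable_integral_comp.
by move=> a; exact: integral_ge0.
Qed.

End pair_laws.

Lemma same_law_sym {dT dU : measure_display} {T : measurableType dT}
    {U : measurableType dU} {R : realType} {P : probability T R}
    {X Y : {RV P >-> U}} : same_law X Y -> same_law Y X.
Proof. by move=> XY A mA; rewrite XY. Qed.

(** * Moments of absolute differences under the mixture law *)

Section absolute_difference.
Context {R : realType}.
Local Open Scope ereal_scope.

Definition absdiff (r : R) (z : R * R) : \bar R := (`|z.1 - z.2| `^ r)%:E.

Lemma absdiff_ge0 r z : 0 <= absdiff r z.
Proof. by rewrite lee_fin powR_ge0. Qed.

Lemma measurable_absdiff r : measurable_fun setT (absdiff r).
Proof.
apply/measurable_EFinP; apply: (measurableT_comp (measurable_powR r)).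
by apply: measurableT_comp => //; exact: measurable_funB.
Qed.

Lemma measurable_absdiffl r b : measurable_fun setT (fun a => absdiff r (a, b)).
Proof.
apply: (measurableT_comp (measurable_absdiff r)).
exact: measurable_fun_pair.
Qed.

Lemma measurable_absdiffr r a : measurable_fun setT (fun b => absdiff r (a, b)).
Proof.
apply: (measurableT_comp (measurable_absdiff r)).
exact: measurable_fun_pair.
Qed.

(** This is the [r]-th moment of the absolute difference of two independent copies of [X]. Two
    copies of the sample space replace a second random variable, and the value stays in the extended
    reals so that Tonelli applies before any finiteness is known. *)
Definition paired_moment {d} {T : measurableType d} (P : probability T R)
    (X : T -> R) (r : R) : \bar R :=
  \int[P]_t \int[P]_u absdiff r (X t, X u).

Lemma paired_moment_ge0 {d} {T : measurableType d} (P : probability T R)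
  (X : T -> R) r : 0 <= paired_moment P X r.
Proof.
apply: integral_ge0 => t _; apply: integral_ge0 => u _; exact: absdiff_ge0.
Qed.

Context {dT dU : measure_display} {T : measurableType dT}
  {U : measurableType dU} {P : probability T R} {Q : probability U R}
  {Y : {RV P >-> R}} {s : R} {V : {RV Q >-> R}}.
Hypothesis YV : sparse_law P Y s V.

Lemma sparse_paired_moment (r : R) : (0 <= s <= 1)%R -> (r != 0)%R ->
  paired_moment P Y r =
  (s ^+ 2)%:E * paired_moment Q V r
  + (2 * (1 - s) * s)%:E * 'E_Q[fun w => (`|V w| `^ r)%R].
Proof.
move=> s01 r0; have /andP[s0 s1] := s01.
have s1' : (0 <= 1 - s)%R by rewrite subr_ge0.
set M := 'E_Q[_].
(* [F a] is the mean of [|a - Y|^r] with the mixture law expanded once; expanding the law of the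
   outer variable then integrates [F] itself. *)
pose F a := s%:E * \int[Q]_w absdiff r (a, V w) + (1 - s)%:E * absdiff r (a, 0%R).
have mI : measurable_fun setT (fun a => \int[Q]_w absdiff r (a, V w)).
  exact: measurable_integral_comp (measurable_absdiff r) (absdiff_ge0 r).
have I0 a : 0 <= \int[Q]_w absdiff r (a, V w).
  by apply: integral_ge0 => w _; exact: absdiff_ge0.
have mF : measurable_fun setT F.
  apply: emeasurable_funD; apply: measurable_funeM => //.
  exact: measurable_absdiffl.
have F0 a : 0 <= F a.
  by apply: adde_ge0; apply: mule_ge0 => //; rewrite ?lee_fin// powR_ge0.
have M_def : \int[Q]_w absdiff r (V w, 0%R) = M.
  rewrite /M expectation.unlock; apply: eq_integral => w _.
  by rewrite /absdiff/= subr0.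
(* Here [r != 0] matters: it makes the term where both variables vanish equal to [0 ^ r = 0]. *)
have F00 : F 0%R = s%:E * M.
  rewrite /F /absdiff/= subrr normr0 powR0// mule0 adde0; congr (_ * _).
  rewrite -M_def; apply: eq_integral => w _.
  by rewrite /absdiff/= sub0r subr0 normrN.
transitivity (\int[P]_t F (Y t)).
  apply: eq_integral => t _.
  rewrite (sparse_law_ge0_integral (fun b => absdiff r (Y t, b)) s01 YV)//.
    exact: measurable_absdiffr.
  by move=> b; exact: absdiff_ge0.
rewrite (sparse_law_ge0_integral F s01 YV)// F00.
have mVI : measurable_fun setT (fun w => \int[Q]_v absdiff r (V w, V v)).
  exact: (measurableT_comp mI).
have mV0 : measurable_fun setT (fun w => absdiff r (V w, 0%R)).
  exact: (measurableT_comp (measurable_absdiffl r 0%R)).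
rewrite ge0_integralD//; last 4 first.
- by move=> w _; rewrite mule_ge0// lee_fin.
- exact: measurable_funeM.
- by move=> w _; rewrite mule_ge0// ?lee_fin// powR_ge0.
- exact: measurable_funeM.
rewrite ge0_integralZl// ge0_integralZl//; last first.
  by move=> w _; exact: absdiff_ge0.
rewrite M_def -/(paired_moment Q V r).
have M0 : 0 <= M by apply: expectation_ge0 => w; exact: powR_ge0.
have A0 := paired_moment_ge0 Q V r.
(* The moments may be infinite, so distributivity rests on nonnegativity. The two cross terms, where
   exactly one of the variables is zeroed, both contribute [s * (1 - s)] times [M]. *)
rewrite ge0_muleDr ?mule_ge0// ?lee_fin// !muleA -!EFinM -addeA -expr2.
rewrite -ge0_muleDl ?lee_fin ?mulr_ge0// -EFinD.
by congr (_ + _%:E * _); ring.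
Qed.

(** A finite sum of nonnegative terms has finite terms, so a moment with a positive coefficient is
    finite and [fine] distributes over the sum. *)
Lemma fine_sparse_paired_moment (r : R) : (0 < s <= 1)%R -> (r != 0)%R ->
  paired_moment P Y r < +oo ->
  fine (paired_moment P Y r) =
  (s ^+ 2 * fine (paired_moment Q V r) + 2 * (1 - s) * s * absmoment Q V r)%R.
Proof.
move=> /andP[s0 s1] r0; rewrite sparse_paired_moment ?(ltW s0)// /absmoment.
have c1 : (0 < s ^+ 2)%R by rewrite exprn_gt0.
have c2 : (0 <= 2 * (1 - s) * s)%R.
  by rewrite !mulr_ge0// ?subr_ge0// ltW.
have : 0 <= 'E_Q[fun w => (`|V w| `^ r)%R].
  by apply: expectation_ge0 => w; exact: powR_ge0.
have := paired_moment_ge0 Q V r.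
move: (paired_moment Q V r) ('E_Q[_]) (s ^+ 2)%R (2 * (1 - s) * s)%R c1 c2.
(* The coefficient [b] vanishes when [s = 1]. The moment of [V] may then be infinite, but its term
   is 0 both before and after [fine]. *)
move=> A B a b a0 b0; have [->|bN0] := eqVneq b 0%R.
  move=> A0 _; rewrite !mul0e adde0 mul0r addr0.
  by case: A A0 => // _; rewrite gt0_muley ?lte_fin.
have {}b0 : (0 < b)%R by rewrite lt_def bN0.
case: A => [A||]//; case: B => [B||]//= _ _; by rewrite ?gt0_muley ?lte_fin.
Qed.

End absolute_difference.

Lemma same_law_paired_moment {dU : measure_display} {U : measurableType dU}
    {R : realType} {Q : probability U R} {V W : {RV Q >-> R}} (r : R) :
  same_law V W -> paired_moment Q V r = paired_moment Q W r.
Proof.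
move=> VW; rewrite /paired_moment.
transitivity (\int[Q]_t \int[Q]_u absdiff r (V t, W u))%E.
  apply: eq_integral => t _.
  apply: (same_law_ge0_integral (fun b => absdiff r (V t, b)) VW).
    exact: measurable_absdiffr.
  by move=> b; exact: absdiff_ge0.
apply: (same_law_ge0_integral (fun a => \int[Q]_u absdiff r (a, W u))%E VW).
  exact: measurable_integral_comp (measurable_absdiff r) (absdiff_ge0 r).
by move=> a; apply: integral_ge0 => u _; exact: absdiff_ge0.
Qed.

Lemma same_law_absmoment {dU : measure_display} {U : measurableType dU}
    {R : realType} {Q : probability U R} {V W : {RV Q >-> R}} (r : R) :
  same_law V W -> absmoment Q V r = absmoment Q W r.
Proof.
move=> VW; rewrite /absmoment expectation.unlock; congr fine.
apply: (same_law_ge0_integral (fun a : R => (`|a| `^ r)%:E) VW).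
  exact/measurable_EFinP/(measurableT_comp (measurable_powR r)).
by move=> a; rewrite lee_fin powR_ge0.
Qed.

(** This identifies the moments [m'] of the theorem with paired moments of [V] alone. *)
Lemma absmoment_sub_indep {dU : measure_display} {U : measurableType dU}
    {R : realType} {Q : probability U R} {V V1 V2 : {RV Q >-> R}} (r : R) :
  independent2 V1 V2 -> same_law V1 V -> same_law V2 V ->
  absmoment Q (V1 \- V2) r = fine (paired_moment Q V r).
Proof.
move=> V12 V1V V2V; rewrite /absmoment expectation.unlock; congr fine.
exact: (indep_same_law_ge0_integral _ V12 V1V V2V (measurable_absdiff r)
  (absdiff_ge0 r)).
Qed.

(** * Mean and variance of the coordinatewise and total distances *)

Section coordinates.
Context {dT : measure_display} {T : measurableType dT} {R : realType}
  {P : probability T R} {n : nat}.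
Local Open Scope ereal_scope.

Lemma measurable_coordRV (x : {RV P >-> n.-tuple R}) (j : 'I_n) :
  measurable_fun setT (coordRV x j).
Proof. exact: (measurableT_comp (@measurable_tnth _ _ _ j)). Qed.

HB.instance Definition _ (x : {RV P >-> n.-tuple R}) (j : 'I_n) :=
  isMeasurableFun.Build _ _ _ _ (coordRV x j) (measurable_coordRV x j).

Lemma independent_coords2 {x : {RV P >-> n.-tuple R}} {i j : 'I_n} :
  independent_coords x -> i != j ->
  independent2 (coordRV x i : {RV P >-> R}) (coordRV x j : {RV P >-> R}).
Proof.
move=> x_indep ij A B mA mB.
(* Joint independence is specialised to the index set [{i, j}], with [A] at [i] and [B] at [j]. *)
have := x_indep [set i; j]%SET (fun k => if k == i then A else B).
have -> : \bigcap_(k in [set` [set i; j]%SET])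
    (coordRV x k @^-1` (if k == i then A else B)) =
    coordRV x i @^-1` A `&` coordRV x j @^-1` B.
  apply/seteqP; split => t /=.
    move=> xt; split.
      by have := xt i; rewrite /= !inE eqxx => /(_ isT).
    by have := xt j; rewrite /= !inE eqxx orbT eq_sym (negbTE ij) => /(_ isT).
  move=> [xiA xjB] k; rewrite /= !inE => /orP[] /eqP->; first by rewrite eqxx.
  by rewrite eq_sym (negbTE ij).
rewrite big_setU1/= ?inE// big_set1 eqxx eq_sym (negbTE ij); apply.
by move=> k; case: ifP.
Qed.

Context {x q : {RV P >-> n.-tuple R}}.
Hypothesis xq_iid : iid2 x q.

Let measurable_absdiff_coord (r : R) (j : 'I_n) :
  measurable_fun setT
    (fun z : n.-tuple R * n.-tuple R => absdiff r (tnth z.1 j, tnth z.2 j)).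
Proof.
apply: (measurableT_comp (measurable_absdiff r)).
apply: measurable_fun_pair.
  exact: (measurableT_comp (measurable_tnth j) measurable_fst).
exact: (measurableT_comp (measurable_tnth j) measurable_snd).
Qed.

(** The query has the law of [x], so averaging over it is averaging over a second copy of [x]. *)
Lemma Rcoord_integral (r : R) (j : 'I_n) (t : T) :
  Rcoord r x q j t = \int[P]_u absdiff r (coordRV x j t, coordRV x j u).
Proof.
rewrite /Rcoord expectation.unlock; apply/esym.
apply: (same_law_ge0_integral
  (fun v : n.-tuple R => absdiff r (coordRV x j t, tnth v j)) (proj1 xq_iid)).
  apply: (measurableT_comp (measurable_absdiffr r (coordRV x j t))).
  exact: measurable_tnth.
by move=> v; exact: absdiff_ge0.
Qed.

Lemma measurable_Rcoord (r : R) (j : 'I_n) :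
  measurable_fun setT (Rcoord r x q j).
Proof.
rewrite (_ : Rcoord r x q j = (fun a => \int[P]_u absdiff r (a, coordRV x j u))
  \o coordRV x j); last by apply/funext => t; exact: Rcoord_integral.
apply: measurableT_comp; last exact: measurable_coordRV.
exact: measurable_integral_comp (measurable_absdiff r) (absdiff_ge0 r).
Qed.

Lemma Rcoord_ge0 (r : R) (j : 'I_n) (t : T) : 0 <= Rcoord r x q j t.
Proof. by apply: expectation_ge0 => u; exact: powR_ge0. Qed.

Lemma integral_Rcoord (r : R) (j : 'I_n) :
  \int[P]_t Rcoord r x q j t = paired_moment P (coordRV x j) r.
Proof. by apply: eq_integral => t _; exact: Rcoord_integral. Qed.

Lemma expectation_pdist_coord (r : R) (j : 'I_n) :
  'E_P[pdist_coord r x q j] = paired_moment P (coordRV x j) r.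
Proof.
rewrite expectation.unlock.
apply: (indep_same_law_ge0_integral _ (proj2 xq_iid) _ _
  (measurable_absdiff_coord r j)) => //.
- exact: same_law_sym (proj1 xq_iid).
- by move=> z; exact: absdiff_ge0.
Qed.

Lemma measurable_pdist_coord (r : R) (j : 'I_n) :
  measurable_fun setT (pdist_coord r x q j).
Proof.
apply/measurable_EFinP.
apply: (measurableT_comp (measurable_absdiff_coord r j)
  (g := fun t => (x t, q t))).
exact: measurable_fun_pair.
Qed.

(* Conditionally on x, the two factors depend on the independent coordinates
   q^i and q^j; what is left is a product of functions of x^i and of x^j. *)
Lemma expectationM_pdist_coord (r : R) (i j : 'I_n) :
  independent_coords x -> i != j ->
  'E_P[pdist_coord r x q i * pdist_coord r x q j] =
  'E_P[pdist_coord r x q i] * 'E_P[pdist_coord r x q j].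
Proof.
move=> x_indep ij; have xij := independent_coords2 x_indep ij.
pose G k a := \int[P]_u absdiff r (a, coordRV x k u).
have mG k : measurable_fun setT (G k).
  exact: measurable_integral_comp (measurable_absdiff r) (absdiff_ge0 r).
have G0 k a : 0 <= G k a.
  by apply: integral_ge0 => u _; exact: absdiff_ge0.
rewrite !expectation_pdist_coord expectation.unlock.
transitivity (\int[P]_t \int[P]_u
    (absdiff r (coordRV x i t, coordRV x i u) *
     absdiff r (coordRV x j t, coordRV x j u))).
  apply: (indep_same_law_ge0_integral (fun z => absdiff r (tnth z.1 i, tnth z.2 i)
    * absdiff r (tnth z.1 j, tnth z.2 j)) (proj2 xq_iid) _) => //.
  - exact: same_law_sym (proj1 xq_iid).
  - by apply: emeasurable_funM; exact: measurable_absdiff_coord.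
  - by move=> z; apply: mule_ge0; exact: absdiff_ge0.
transitivity (\int[P]_t (G i (coordRV x i t) * G j (coordRV x j t))).
  apply: eq_integral => t _.
  apply: (ge0_integralM_indep xij (fun b => absdiff r (coordRV x i t, b))
    (fun b => absdiff r (coordRV x j t, b)));
    by [exact: measurable_absdiffr|move=> b; exact: absdiff_ge0].
exact: (ge0_integralM_indep xij).
Qed.

Context {p : R}.
Hypothesis R_finite : forall j, finite_mean_variance p x q j.

Lemma paired_moment_fin_num (j : 'I_n) :
  paired_moment P (coordRV x j) p \is a fin_num.
Proof.
rewrite ge0_fin_numE ?paired_moment_ge0// -integral_Rcoord.
by have [] := R_finite j.
Qed.

Lemma mu_sum : mu p x q = (\sum_j fine (paired_moment P (coordRV x j) p))%R.
Proof.
rewrite /mu /Rtot ge0_integral_sum//; last 2 first.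
- by move=> j; exact: measurable_Rcoord.
- by move=> j t _; exact: Rcoord_ge0.
under eq_bigr do rewrite integral_Rcoord.
by rewrite -sum_fine// => j _; exact: paired_moment_fin_num.
Qed.

Lemma pdist_coord_Lfun2 (j : 'I_n) : pdist_coord p x q j \in Lfun P 2%:E.
Proof.
apply: variance_lty_Lfun2; first exact: measurable_pdist_coord.
by have [] := R_finite j.
Qed.

Lemma sqr_pdist_coord (j : 'I_n) :
  (pdist_coord p x q j ^+ 2)%R = pdist_coord (2 * p) x q j.
Proof.
apply/funext => t; rewrite /pdist_coord mulrC powRrM powR_mulrn ?powR_ge0//.
Qed.

(** Finite variance makes [pdist_coord p x q j] square integrable, and its square is the same
    distance with exponent [2 * p]. This is the finiteness under which the mixture formula for the
    second moment holds in the reals. *)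
Lemma paired_moment_double_lty (j : 'I_n) :
  paired_moment P (coordRV x j) (2 * p) < +oo.
Proof.
have Y2 := pdist_coord_Lfun2 j.
rewrite -expectation_pdist_coord -sqr_pdist_coord -ge0_fin_numE.
  by rewrite expectation_fin_num// expr2 Lfun2_mul_Lfun1.
by apply: expectation_ge0 => t; exact: sqr_ge0.
Qed.

Lemma sigma2_sum : independent_coords x ->
  sigma2 p x q = (\sum_j (fine (paired_moment P (coordRV x j) (2 * p))
    - fine (paired_moment P (coordRV x j) p) ^+ 2))%R.
Proof.
move=> x_indep; rewrite /sigma2.
have -> : pdist p x q = (\sum_j pdist_coord p x q j)%R.
  by apply/funext => t; rewrite fct_sumE.
rewrite variance_sum_uncorrelated; last 2 first.
- exact: pdist_coord_Lfun2.
- by move=> i j ij; exact: expectationM_pdist_coord.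
rewrite -sum_fine; last by move=> j _; exact/variance_fin_num/pdist_coord_Lfun2.
apply: eq_bigr => j _; have Y2 := pdist_coord_Lfun2 j.
have EYY : 'E_P[pdist_coord p x q j ^+ 2] \is a fin_num.
  by rewrite expectation_fin_num// expr2 Lfun2_mul_Lfun1.
have EY : 'E_P[pdist_coord p x q j] \is a fin_num.
  by rewrite expectation_pdist_coord paired_moment_fin_num.
(* The variance is the second moment minus the squared mean; both being finite, [fine] passes
   through. *)
rewrite varianceE// fineB ?fin_numX// expe2 fineM// -expr2.
by rewrite sqr_pdist_coord !expectation_pdist_coord.
Qed.

End coordinates.

(** * Equal dimensions and the closed formulas *)

Lemma sqrt_normalized_variance_iid {R : rcfType} (n : nat) (A u : R) : (0 < n)%N ->
  Num.sqrt ((\sum_(i < n) (A - u ^+ 2)) / (\sum_(i < n) u) ^+ 2) =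
  (Num.sqrt n%:R)^-1 * Num.sqrt (A / u ^+ 2 - 1).
Proof.
move=> n0; rewrite !sumr_const card_ord -[_ *+ n]mulr_natl -[u *+ n]mulr_natl.
have nN0 : n%:R != 0 :> R by rewrite pnatr_eq0 -lt0n.
(* For u = 0 both sides are junk values: y / 0 = 0 and sqrt (-1) = 0. *)
have [->|uN0] := eqVneq u 0.
  have sqrtN1 : Num.sqrt (-1) = 0 :> R by apply: ler0_sqrtr; rewrite lerN10.
  by rewrite mulr0 expr0n/= invr0 !mulr0 sub0r sqrtr0 sqrtN1 mulr0.
rewrite -sqrtrV ?ler0n// -sqrtrM ?invr_ge0 ?ler0n//; congr Num.sqrt.
by field; rewrite uN0.
Qed.

Theorem theorem2p2 (R : realType)
    (dT : measure_display) (T : measurableType dT) (P : probability T R)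
    (dU : measure_display) (U : measurableType dU) (Q : probability U R)
    (d : nat) (p : R) (x q : {RV P >-> d.-tuple R})
    (s : 'I_d -> R) (V V1 V2 : 'I_d -> {RV Q >-> R})
    (p_gt0 : 0 < p)
    (xq_iid : iid2 x q)
    (s_bounds : forall j, 0 < s j <= 1)
    (x_law : forall j, sparse_law P (coordRV x j) (s j) (V j))
    (q_law : forall j, sparse_law P (coordRV q j) (s j) (V j))
    (V1_law : forall j, same_law (V1 j) (V j))
    (V2_law : forall j, same_law (V2 j) (V j))
    (V12_indep : forall j, independent2 (V1 j) (V2 j))
    (R_finite : forall j, finite_mean_variance p x q j)
    (dims_indep : independent_coords x) :
  let m := fun j r => absmoment Q (V j) r in
  let m' := fun j r => absmoment Q (V1 j \- V2 j) r in
  let mu_ := fun j => s j ^+ 2 * m' j p + 2 * (1 - s j) * s j * m j p in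
  normalized_variance p x q =
    (\sum_(j < d) (s j ^+ 2 * m' j (2 * p)
                   + 2 * (1 - s j) * s j * m j (2 * p) - mu_ j ^+ 2))
    / (\sum_(j < d) mu_ j) ^+ 2
  /\
  ((forall i j, s i = s j) -> (forall i j, same_law (V i) (V j)) ->
   forall j : 'I_d,
   normalized_sd p x q =
     1 / (d%:R `^ (1 / 2)) *
     Num.sqrt (s j * ((m' j (2 * p) - 2 * m j (2 * p)) * s j + 2 * m j (2 * p))
               / (s j ^+ 2 * ((m' j p - 2 * m j p) * s j + 2 * m j p) ^+ 2)
               - 1)).
Proof.
move=> m m' mu_; have p0 : p != 0 by rewrite gt_eqF.
have p20 : 2 * p != 0 by rewrite mulf_neq0.
have m'E j r : m' j r = fine (paired_moment Q (V j) r).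
  exact: absmoment_sub_indep.
(* The finite mean justifies the real mixture formula at exponent [p], the finite variance the one
   at [2 * p]. *)
have firstE j : fine (paired_moment P (coordRV x j) p) = mu_ j.
  rewrite (fine_sparse_paired_moment (x_law j))// -?m'E//.
  by have := paired_moment_fin_num xq_iid R_finite j;
    rewrite ge0_fin_numE// paired_moment_ge0.
have secondE j : fine (paired_moment P (coordRV x j) (2 * p)) =
    s j ^+ 2 * m' j (2 * p) + 2 * (1 - s j) * s j * m j (2 * p).
  rewrite (fine_sparse_paired_moment (x_law j))// -?m'E//.
  exact: (paired_moment_double_lty xq_iid R_finite).
have nvE : normalized_variance p x q =
    (\sum_(j < d) (s j ^+ 2 * m' j (2 * p)
                   + 2 * (1 - s j) * s j * m j (2 * p) - mu_ j ^+ 2))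
    / (\sum_(j < d) mu_ j) ^+ 2.
  rewrite /normalized_variance (mu_sum xq_iid R_finite).
  rewrite (sigma2_sum xq_iid R_finite dims_indep); congr (_ / _ ^+ 2).
    apply: eq_bigr => j _.
    by congr (_ - _ ^+ 2); [exact: secondE|exact: firstE].
  by apply: eq_bigr => j _; exact: firstE.
split=> // sE VE j.
have mE i r : m i r = m j r by exact: same_law_absmoment.
have m'jE i r : m' i r = m' j r.
  by rewrite !m'E (same_law_paired_moment r (VE i j)).
have muE i : mu_ i = mu_ j by rewrite /mu_ mE m'jE (sE i j).
rewrite /normalized_sd nvE.
under eq_bigr do rewrite mE m'jE (sE _ j) muE.
under [X in _ / X ^+ 2]eq_bigr do rewrite muE.
(* The index [j] itself witnesses that there is at least one dimension. *)
have d0 : (0 < d)%N by exact: leq_ltn_trans (ltn_ord j).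
rewrite sqrt_normalized_variance_iid// !div1r powR12_sqrt//.
(* What remains is to factor [s j] out of the second moment and out of [mu_ j], the latter
   squared. *)
congr (_ * Num.sqrt (_ / _ - 1)); first by ring.
by rewrite /mu_; ring.
Qed.
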